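(* Let $n=3$, $\eta,\chi_3\in\mathbb R$, $\kappa>-1$ and let $\gamma\in\mathbb R^3$ be a unit vector. Consider on $(T^*V_{3,2},\omega_\eta)$ the Hamiltonian flow of $$H_\kappa=\tfrac12\langle \mathbf p_1,\mathbf p_1\rangle+\tfrac12\langle \mathbf p_2,\mathbf p_2\rangle-(1+2\kappa)\langle \mathbf p_1,\mathbf e_2\rangle\langle \mathbf p_2,\mathbf e_1\rangle+V_I,\qquad V_I=-\langle\Xi\mathbf e_1,\mathbf e_2\rangle=\chi_3\langle\gamma,\mathbf e_3\rangle,$$ where $\mathbf e_3=\mathbf e_1\times\mathbf e_2$ and $\Xi\in so(3)$ is given by $\Xi w=-\chi_3\,\gamma\times w$. Then, under the identification $V_{3,2}\cong SO(3)$, this flow represents the motion of a system Lagrange top + gyrostat around a fixed point in the presence of the homogeneous gravitational field, where the inertia operator is $I=\operatorname{diag}\big(1,1,\tfrac1{1+\kappa}\big)$, the gyrostat momentum is $\mathbf L=(0,0,-\eta)$, and the position of the center of mass of the system body+gyrostat, multiplied by the mass $m$ of the system and the gravitational constant $g$, is $\chi=(0,0,\chi_3)$.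
   Context: **Phase space.** $V_{3,2}=\{(\mathbf e_1,\mathbf e_2)\in\mathbb R^{3}\times\mathbb R^3 : |\mathbf e_1|=|\mathbf e_2|=1,\ \langle \mathbf e_1,\mathbf e_2\rangle=0\}$. $T^*V_{3,2}$ is realized as the set of $(\mathbf e_1,\mathbf e_2,\mathbf p_1,\mathbf p_2)\in\mathbb R^{12}$ with $(\mathbf e_1,\mathbf e_2)\in V_{3,2}$, $\langle \mathbf e_1,\mathbf p_1\rangle=\langle \mathbf e_2,\mathbf p_2\rangle=0$, $\langle \mathbf e_1,\mathbf p_2\rangle+\langle \mathbf e_2,\mathbf p_1\rangle=0$. The twisted symplectic form $\omega_\eta$ is the restriction to $T^*V_{3,2}$ of $\sum_i(dp_1^i\wedge de_1^i+dp_2^i\wedge de_2^i)+\eta\sum_i de_1^i\wedge de_2^i$, with the sign convention that in the ambient space the Hamiltonian equations are $\dot{\mathbf e}_i=\partial H/\partial\mathbf p_i$, $\dot{\mathbf p}_1=-\partial H/\partial\mathbf e_1+\eta\,\partial H/\partial\mathbf p_2$, $\dot{\mathbf p}_2=-\partial H/\partial\mathbf e_2-\eta\,\partial H/\partial\mathbf p_1$. **Identification with $SO(3)$.** $(\mathbf e_1,\mathbf e_2)\mapsto R=(\mathbf e_1\ \mathbf e_2\ \mathbf e_3)\in SO(3)$; $R$ maps the frame attached to the body to the fixed frame. For $v\in\mathbb R^3$ let $\hat v$ be the skew matrix with $\hat v w=v\times w$. With $x\wedge y=xy^T-yx^T$ and $\Phi_0=\mathbf p_1\wedge\mathbf e_1+\mathbf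 p_2\wedge\mathbf e_2$, the body momentum $\mathbf M$ is defined by $\hat{\mathbf M}=R^T\Phi_0R$, i.e. $M_1=\langle\mathbf p_2,\mathbf e_3\rangle$, $M_2=-\langle \mathbf p_1,\mathbf e_3\rangle$, $M_3=\langle\mathbf p_1,\mathbf e_2\rangle-\langle\mathbf p_2,\mathbf e_1\rangle$. $\Gamma=R^T\gamma$ is the vector $\gamma$ in the body frame. **Heavy rigid body with a gyrostat.** For inertia operator $I$, constant gyrostat momentum $\mathbf L$ in the body frame, and $\chi$ = position of the center of mass (body frame) multiplied by $mg$, the Euler–Poisson equations are $$\dot{\mathbf M}=(\mathbf M+\mathbf L)\times\Omega+\Gamma\times\chi,\qquad \dot\Gamma=\Gamma\times\Omega,\qquad \Omega=I^{-1}\mathbf M,$$ with $\Omega$ the angular velocity in the body frame, $\dot R=R\hat\Omega$. The Lagrange top with a gyrostat is the case $I=\operatorname{diag}(I_1,I_1,I_3)$, $\chi=(0,0,\chi_3)$, $\mathbf L$ along the third axis. ''Represents'' means that, under the correspondence $(\mathbf e_1,\mathbf e_2,\mathbf p_1,\mathbf p_2)\leftrightarrow(R,\mathbf M)$, the Hamiltonian flow is given by these equations with $\Gamma=R^T\gamma$. *)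

(* Defs.v *)
From mathcomp Require Export all_boot all_order all_algebra.
From mathcomp Require Export all_classical all_reals all_analysis.
From mathcomp Require Import ring.
Set Implicit Arguments.
Unset Strict Implicit.
Unset Printing Implicit Defensive.
Export Order.TTheory GRing.Theory Num.Theory.
Export numFieldNormedType.Exports.
Local Open Scope classical_set_scope.
Local Open Scope ring_scope.

(* The library norm on 'cV[K]_3 is the sup norm; Euclidean lengths are always
   expressed through dot. *)
Definition dot (K : realType) (x y : 'cV[K]_3) : K :=
  \sum_(i < 3) x i 0 * y i 0.

Definition vec3 (K : realType) (a b c : K) : 'cV[K]_3 :=
  \col_(i < 3) [:: a; b; c]`_i.

Definition cross (K : realType) (x y : 'cV[K]_3) : 'cV[K]_3 :=
  vec3 (x 1 0 * y 2%:R 0 - x 2%:R 0 * y 1 0)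
       (x 2%:R 0 * y 0 0 - x 0 0 * y 2%:R 0)
       (x 0 0 * y 1 0 - x 1 0 * y 0 0).

Definition hat (K : realType) (v : 'cV[K]_3) : 'M[K]_3 :=
  \matrix_(i < 3, j < 3) (nth [::] [:: [:: 0; - v 2%:R 0; v 1 0];
                                      [:: v 2%:R 0; 0; - v 0 0];
                                      [:: - v 1 0; v 0 0; 0]] i)`_j.

Definition vee (K : realType) (A : 'M[K]_3) : 'cV[K]_3 :=
  vec3 (A 2%:R 1) (A 0 2%:R) (A 1 0).

Definition wedge (K : realType) (x y : 'cV[K]_3) : 'M[K]_3 :=
  x *m y^T - y *m x^T.

Definition so3 (K : realType) : set 'M[K]_3 := [set A | A^T = - A].

Definition SO3 (K : realType) : set 'M[K]_3 :=
  [set A | A^T *m A = 1%:M /\ \det A = 1].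

(* The ambient space R^12, a point being ((e1, e2), (p1, p2)); the same type is
   used for its tangent vectors. *)
Notation ambient K := (('cV[K]_3 * 'cV[K]_3) * ('cV[K]_3 * 'cV[K]_3))%type.

Definition e1 (K : realType) (z : ambient K) : 'cV[K]_3 := z.1.1.
Definition e2 (K : realType) (z : ambient K) : 'cV[K]_3 := z.1.2.
Definition p1 (K : realType) (z : ambient K) : 'cV[K]_3 := z.2.1.
Definition p2 (K : realType) (z : ambient K) : 'cV[K]_3 := z.2.2.
Definition e3 (K : realType) (z : ambient K) : 'cV[K]_3 := cross (e1 z) (e2 z).

Definition constraints (K : realType) (z : ambient K) : K * K * K * K * K * K :=
  (dot (e1 z) (e1 z) - 1, dot (e2 z) (e2 z) - 1, dot (e1 z) (e2 z),
   dot (e1 z) (p1 z), dot (e2 z) (p2 z), dot (e1 z) (p2 z) + dot (e2 z) (p1 z)).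

Definition TstarV (K : realType) : set (ambient K) :=
  [set z | constraints z = (0, 0, 0, 0, 0, 0)].

(* 0 is a regular value of constraints, so this is the tangent space of
   TstarV at z. *)
Definition tangent (K : realType) (z : ambient K) : set (ambient K) :=
  [set X | 'd (@constraints K) z X = (0, 0, 0, 0, 0, 0)].

(* sum_i (dp1^i /\ de1^i + dp2^i /\ de2^i) + eta sum_i de1^i /\ de2^i; its
   coefficients are constant, so the base point is not an argument. *)
Definition omega (K : realType) (eta : K) (X Y : ambient K) : K :=
  (dot (p1 X) (e1 Y) - dot (p1 Y) (e1 X))
  + (dot (p2 X) (e2 Y) - dot (p2 Y) (e2 X))
  + eta * (dot (e1 X) (e2 Y) - dot (e1 Y) (e2 X)).

(* X is the value at z of the Hamiltonian vector field of H on TstarV with the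
   restricted form: the convention is i_X omega = - dH, whose signs are those
   of omega_ambient below. *)
Definition hamiltonian_vector (K : realType) (eta : K) (H : ambient K -> K)
    (z X : ambient K) : Prop :=
  tangent z X /\ forall Y, tangent z Y -> omega eta X Y = - 'd H z Y.

(* If dH has components (a1, a2, b1, b2), then without constraints the equation
   i_X omega = - dH is solved by e1' = b1, e2' = b2, p1' = - a1 + eta b2,
   p2' = - a2 - eta b1. *)
Lemma omega_ambient (K : realType) (eta : K) (a1 a2 b1 b2 : 'cV[K]_3)
    (Y : ambient K) :
  omega eta ((b1, b2), (- a1 + eta *: b2, - a2 - eta *: b1)) Y =
  - (dot a1 (e1 Y) + dot a2 (e2 Y) + dot b1 (p1 Y) + dot b2 (p2 Y)).
Proof.
rewrite /omega /dot /e1 /e2 /p1 /p2 !big_ord_recl !big_ord0 /= !mxE.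
by ring.
Qed.

Definition open_interval (K : realType) (J : set K) : Prop :=
  open J /\ is_interval J.

Definition integral_curve (K : realType) (eta : K) (H : ambient K -> K)
    (J : set K) (z : K -> ambient K) : Prop :=
  forall t, J t -> exists2 X, hamiltonian_vector eta H (z t) X & is_derive t 1 z X.

Definition frame (K : realType) (z : ambient K) : 'M[K]_3 :=
  \matrix_(i < 3, j < 3) [:: e1 z; e2 z; e3 z]`_j i 0.

Definition Phi0 (K : realType) (z : ambient K) : 'M[K]_3 :=
  wedge (p1 z) (e1 z) + wedge (p2 z) (e2 z).

Definition body_momentum (K : realType) (z : ambient K) : 'cV[K]_3 :=
  vee ((frame z)^T *m Phi0 z *m frame z).

Definition correspondence (K : realType) (z : ambient K) : 'M[K]_3 * 'cV[K]_3 :=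
  (frame z, body_momentum z).

Lemma hat_mul (K : realType) (v w : 'cV[K]_3) : hat v *m w = cross v w.
Proof.
apply/matrixP => i j; rewrite (ord1 j) !mxE !big_ord_recl big_ord0.
have -> : lift ord0 ord0 = 1 :> 'I_3 by exact/val_inj.
have -> : lift ord0 (lift ord0 ord0) = 2%:R :> 'I_3 by exact/val_inj.
by case: i => -[|[|[|//]]] hi; rewrite !mxE /=; ring.
Qed.

Lemma hat_vee (K : realType) (A : 'M[K]_3) : so3 A -> hat (vee A) = A.
Proof.
rewrite /so3 /= => /matrixP hA.
have E i j : A j i = - A i j by have := hA i j; rewrite !mxE.
have D i : A i i = 0.
  by apply/eqP; move: (E i i) => /eqP; rewrite -addr_eq0 -mulr2n mulrn_eq0.
have o0 : 0 = @Ordinal 3 0 isT by exact/val_inj.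
have o1 : 1 = @Ordinal 3 1 isT by exact/val_inj.
have o2 : 2%:R = @Ordinal 3 2 isT by exact/val_inj.
apply/matrixP => -[[|[|[|//]]] hi] -[[|[|[|//]]] hj]; rewrite !mxE /= ?mxE /=.
all: rewrite ?o2 ?o0 ?o1 ?(bool_irrelevance hi isT) ?(bool_irrelevance hj isT).
all: by rewrite ?D -?E.
Qed.

Lemma hat_body_momentum (K : realType) (z : ambient K) :
  hat (body_momentum z) = (frame z)^T *m Phi0 z *m frame z.
Proof.
have hPhi : (Phi0 z)^T = - Phi0 z.
  have hw (x y : 'cV[K]_3) : (wedge x y)^T = - wedge x y.
    by rewrite /wedge [LHS]linearB /= !trmx_mul !trmxK opprB.
  by rewrite /Phi0 [LHS]linearD /= !hw -opprD.
by apply: hat_vee; rewrite /so3 /= !trmx_mul trmxK hPhi mulNmx mulmxN mulmxA.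
Qed.

Definition euler_poisson (K : realType) (I : 'M[K]_3) (L chi gamma : 'cV[K]_3)
    (A : K -> 'M[K]_3) (M : K -> 'cV[K]_3) (t : K) : Prop :=
  let Gamma := fun s => (A s)^T *m gamma in
  let Omega := invmx I *m M t in
  [/\ is_derive t 1 A (A t *m hat Omega),
      is_derive t 1 M (cross (M t + L) Omega + cross (Gamma t) chi)
    & is_derive t 1 Gamma (cross (Gamma t) Omega)].

Definition lagrange_top_gyrostat (K : realType) (I : 'M[K]_3)
    (L chi : 'cV[K]_3) : Prop :=
  exists I1 I3 L3 chi3 : K,
    [/\ 0 < I1, 0 < I3, I = diag_mx (vec3 I1 I1 I3)^T,
        L = vec3 0 0 L3 & chi = vec3 0 0 chi3].

(* The first two clauses make the correspondence and the Hamiltonian vector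
   field well defined; the last one identifies the integral curves on every
   open interval with the motions of the body. *)
Definition represents (K : realType) (eta : K) (H : ambient K -> K)
    (I : 'M[K]_3) (L chi gamma : 'cV[K]_3) : Prop :=
  [/\ set_bij (@TstarV K) (@SO3 K `*` [set: 'cV[K]_3]) (@correspondence K),
      forall z, TstarV z -> exists! X, hamiltonian_vector eta H z X
    & forall (J : set K) (z : K -> ambient K), open_interval J ->
        (forall t, J t -> TstarV (z t)) ->
        (integral_curve eta H J z <->
         forall t, J t ->
           euler_poisson I L chi gamma
             (fun s => frame (z s)) (fun s => body_momentum (z s)) t)].

Definition V_I (K : realType) (Xi : 'M[K]_3) (z : ambient K) : K :=
  - dot (Xi *m e1 z) (e2 z).

Definition H_ (K : realType) (kappa : K) (Xi : 'M[K]_3) (z : ambient K) : K :=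
  2^-1 * dot (p1 z) (p1 z) + 2^-1 * dot (p2 z) (p2 z)
  - (1 + 2 * kappa) * (dot (p1 z) (e2 z) * dot (p2 z) (e1 z)) + V_I Xi z.

(* Main.v *)
Require Import Defs.
From mathcomp Require Import ring lra.
Set Implicit Arguments.
Unset Strict Implicit.
Unset Printing Implicit Defensive.
Local Open Scope classical_set_scope.
Local Open Scope ring_scope.

(* Orthonormality of (e1, e2) forces (p1, p2) to be a linear function of the
   frame R and the body momentum M:
     p1 = (M3 / 2) e2 - M2 e3,   p2 = M1 e3 - (M3 / 2) e1
   (M1, M2, M3 are the entries 0, 1, 2 of M), which gives the bijection of the
   phase space with SO(3) x R^3. Differentiating these formulas with
   R' = R hat(w) and M' = m parametrizes the tangent space at z by the pairs
   (w, m) in R^3 x R^3. In this moving frame the twisted form is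
     <m, w'> - <m', w> - <M + L, w x w'>,   L = (0, 0, - eta),
   and dH is <Omega, m> + <chi, Gamma x w>. Testing i_X omega = - dH with w' = 0
   and with m' = 0 gives its unique solution w = Omega,
   m = (M + L) x Omega + Gamma x chi. *)

Lemma ord3_ind (P : 'I_3 -> Prop) : P 0 -> P 1 -> P 2%:R -> forall i, P i.
Proof.
move=> P0 P1 P2 [[|[|[|//]]] hi].
- by rewrite (_ : Ordinal hi = 0) //; exact/val_inj.
- by rewrite (_ : Ordinal hi = 1) //; exact/val_inj.
- by rewrite (_ : Ordinal hi = 2%:R) //; exact/val_inj.
Qed.

Lemma sum_ord3 (V : zmodType) (F : 'I_3 -> V) :
  \sum_(i < 3) F i = F 0 + F 1 + F 2%:R.
Proof.
rewrite !big_ord_recl big_ord0 addr0 addrA.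
by congr (F _ + F _ + F _); exact/val_inj.
Qed.

(** * Scalar, vector and triple products in three dimensions *)

Section Vectors.
Variable K : realType.
Implicit Types (x y u v w : 'cV[K]_3) (a b c : K) (R : 'M[K]_3).

Lemma col3P x y :
  x 0 0 = y 0 0 -> x 1 0 = y 1 0 -> x 2%:R 0 = y 2%:R 0 -> x = y.
Proof.
move=> h0 h1 h2; apply/matrixP => i j; rewrite (ord1 j).
by move: i; apply: ord3_ind.
Qed.

Lemma vec3E a b c :
  (vec3 a b c 0 0 = a) * (vec3 a b c 1 0 = b) * (vec3 a b c 2%:R 0 = c).
Proof. by rewrite !mxE. Qed.

Lemma dotE x y :
  dot x y = x 0 0 * y 0 0 + x 1 0 * y 1 0 + x 2%:R 0 * y 2%:R 0.
Proof. by rewrite /dot sum_ord3. Qed.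

Lemma dotC x y : dot x y = dot y x.
Proof. by rewrite !dotE; ring. Qed.

Lemma dotDl x y v : dot (x + y) v = dot x v + dot y v.
Proof. by rewrite !dotE !mxE; ring. Qed.
Lemma dotDr x y v : dot v (x + y) = dot v x + dot v y.
Proof. by rewrite !dotE !mxE; ring. Qed.
Lemma dotNl x v : dot (- x) v = - dot x v.
Proof. by rewrite !dotE !mxE; ring. Qed.
Lemma dotNr x v : dot v (- x) = - dot v x.
Proof. by rewrite !dotE !mxE; ring. Qed.
Lemma dotZl a x v : dot (a *: x) v = a * dot x v.
Proof. by rewrite !dotE !mxE; ring. Qed.
Lemma dotZr a x v : dot v (a *: x) = a * dot v x.
Proof. by rewrite !dotE !mxE; ring. Qed.

Definition dot_lin := (dotDl, dotDr, dotNl, dotNr, dotZl, dotZr).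

Lemma dot_crossl x y : dot x (cross x y) = 0.
Proof. by rewrite dotE /cross !vec3E; ring. Qed.

Lemma dot_crossr x y : dot y (cross x y) = 0.
Proof. by rewrite dotE /cross !vec3E; ring. Qed.

Lemma dot_cross_cross x y u v :
  dot (cross x y) (cross u v) = dot x u * dot y v - dot x v * dot y u.
Proof. by rewrite !dotE /cross !vec3E; ring. Qed.

Lemma cross_crossl x y v : cross (cross x y) v = dot x v *: y - dot y v *: x.
Proof. by apply: col3P; rewrite !dotE /cross !vec3E !mxE; ring. Qed.

Lemma hat_tr v : (hat v)^T = - hat v.
Proof.
apply/matrixP; apply: ord3_ind; apply: ord3_ind;
by rewrite !mxE /= ?oppr0 ?opprK.
Qed.

(** Nondegeneracy of the scalar product, by testing on the standard basis. It later extracts the two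
    components of the Hamiltonian vector from an identity in arbitrary test vectors. *)
Lemma dot_eq x y : (forall v, dot v x = dot v y) -> x = y.
Proof.
move=> h; have := (h (vec3 1 0 0), h (vec3 0 1 0), h (vec3 0 0 1)).
rewrite !dotE !vec3E !mul0r !mul1r !addr0 !add0r => -[[h0 h1] h2].
exact: col3P.
Qed.

Lemma triple x y v : dot (cross x y) v = dot x (cross y v).
Proof. by rewrite !dotE /cross !vec3E; ring. Qed.

Lemma triple_cycle x y v : dot x (cross y v) = dot v (cross x y).
Proof. by rewrite -triple dotC. Qed.

Lemma crossC x y : cross x y = - cross y x.
Proof. by apply: col3P; rewrite !mxE /=; ring. Qed.
Lemma cross_self x : cross x x = 0.
Proof. by apply: col3P; rewrite !mxE /=; ring. Qed.
Lemma crossDl x y v : cross (x + y) v = cross x v + cross y v.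
Proof. by apply: col3P; rewrite !mxE /=; ring. Qed.
Lemma crossDr x y v : cross v (x + y) = cross v x + cross v y.
Proof. by apply: col3P; rewrite !mxE /=; ring. Qed.
Lemma crossNl x v : cross (- x) v = - cross x v.
Proof. by apply: col3P; rewrite !mxE /=; ring. Qed.
Lemma crossNr x v : cross v (- x) = - cross v x.
Proof. by apply: col3P; rewrite !mxE /=; ring. Qed.
Lemma crossZl (a : K) x v : cross (a *: x) v = a *: cross x v.
Proof. by apply: col3P; rewrite !mxE /=; ring. Qed.
Lemma crossZr (a : K) x v : cross v (a *: x) = a *: cross v x.
Proof. by apply: col3P; rewrite !mxE /=; ring. Qed.

Definition cross_lin := (crossDl, crossDr, crossNl, crossNr, crossZl, crossZr).

(** Cofactor expansion, rearranged as a triple product of columns. In this form the condition of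
    determinant one decides the sign of the third column relative to the cross product of the first
    two. *)
Lemma det_mx3 R : \det R =
  dot (col 2%:R R) (cross (col 0 R) (col 1 R)).
Proof.
have detE2 (A : 'M[K]_2) : \det A = A 0 0 * A 1 1 - A 0 1 * A 1 0.
  rewrite (expand_det_row _ 0) !big_ord_recl big_ord0 /cofactor !det_mx11 !mxE /=.
  have -> : lift 0 0 = 1 :> 'I_2 by exact/val_inj.
  have -> : lift 1 0 = 0 :> 'I_2 by exact/val_inj.
  by rewrite addn0 expr0 expr1; ring.
rewrite (expand_det_row _ 0) sum_ord3 /cofactor !detE2 dotE /cross !vec3E !mxE.
have -> : lift 0 0 = 1 :> 'I_3 by exact/val_inj.
have -> : lift 0 1 = 2%:R :> 'I_3 by exact/val_inj.
have -> : lift 1 0 = 0 :> 'I_3 by exact/val_inj.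
have -> : lift 1 1 = 2%:R :> 'I_3 by exact/val_inj.
have -> : lift 2%:R 0 = 0 :> 'I_3 by exact/val_inj.
have -> : lift 2%:R 1 = 1 :> 'I_3 by exact/val_inj.
rewrite /= expr0 expr1 sqrrN expr1n; ring.
Qed.

End Vectors.

(** * Directional derivatives of pairs, matrices and products *)

Section Calculus.
Variables (K : realType) (V : normedModType K).
Implicit Types (t v : V).

(** Existence of the derivative and its value are merged into one convergence, which passes directly
    to and from the components of a pair. *)
Lemma is_deriveP_cvg (W : normedModType K) (f : V -> W) t v df :
  is_derive t v f df <->
  (h^-1 *: (f (h *: v + t) - f t)) @[h --> (0 : K)^'] --> df.
Proof.
split=> [[+ <-]|cf]; first by move=> /cvg_ex[l cf]; rewrite /derive (cvg_lim _ cf).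
by apply: DeriveDef; [apply/cvg_ex; exists df|exact: cvg_lim].
Qed.

Lemma is_derive_pairP (W1 W2 : normedModType K) (f : V -> W1 * W2) t v df :
  is_derive t v f df <->
  is_derive t v (fun s => (f s).1) df.1 /\ is_derive t v (fun s => (f s).2) df.2.
Proof.
split=> [/is_deriveP_cvg cf|[/is_deriveP_cvg c1 /is_deriveP_cvg c2]].
  split; apply/is_deriveP_cvg.
    exact: (cvg_comp _ _ cf cvg_fst).
  exact: (cvg_comp _ _ cf cvg_snd).
apply/is_deriveP_cvg; case: df c1 c2 => d1 d2 /= c1 c2.
exact: (cvg_pair c1 c2).
Qed.

Lemma is_derive_mxP m n (A : V -> 'M[K]_(m, n)) t v dA :
  is_derive t v A dA <->
  forall i j, is_derive t v (fun s => A s i j) (dA i j).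
Proof.
split=> [[Ad <-] i j|Ad].
  rewrite derive_mx // mxE; apply: derivableP.
  by move/derivable_mxP : Ad.
have dA' : derivable A t v by apply/derivable_mxP => i j; have [] := Ad i j.
apply: DeriveDef => //; rewrite derive_mx //.
by apply/matrixP => i j; rewrite mxE; have [_ ->] := Ad i j.
Qed.

(** The product rule with factors kept in their original order, so that it matches the matrix
    product rule entry by entry. *)
Lemma is_derive_mul (f g : V -> K) t v df dg :
  is_derive t v f df -> is_derive t v g dg ->
  is_derive t v (fun s => f s * g s) (df * g t + f t * dg).
Proof.
move=> fd gd; apply: (is_derive_eq (is_deriveM fd gd)).
by rewrite addrC; congr (_ + _); rewrite mulrC.
Qed.

Lemma is_derive_add (W : normedModType K) (f g : V -> W) t v df dg :
  is_derive t v f df -> is_derive t v g dg ->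
  is_derive t v (fun s => f s + g s) (df + dg).
Proof. exact: is_deriveD. Qed.

Lemma is_derive_sub (W : normedModType K) (f g : V -> W) t v df dg :
  is_derive t v f df -> is_derive t v g dg ->
  is_derive t v (fun s => f s - g s) (df - dg).
Proof. exact: is_deriveB. Qed.

Lemma is_derive_opp (W : normedModType K) (f : V -> W) t v df :
  is_derive t v f df -> is_derive t v (fun s => - f s) (- df).
Proof. exact: is_deriveN. Qed.

Lemma is_derive_mulmx m n p (A : V -> 'M[K]_(m, n)) (B : V -> 'M[K]_(n, p))
    t v dA dB :
  is_derive t v A dA -> is_derive t v B dB ->
  is_derive t v (fun s => A s *m B s) (dA *m B t + A t *m dB).
Proof.
move=> /is_derive_mxP Ad /is_derive_mxP Bd; apply/is_derive_mxP => i j.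
rewrite !mxE -big_split /=.
rewrite (_ : (fun s => _) =
    \sum_(k < n) (fun s => A s i k * B s k j)); last first.
  by apply/funext => s; rewrite mxE fct_sumE.
by apply: is_derive_sum => k; exact: is_derive_mul.
Qed.

Lemma is_derive_trmx m n (A : V -> 'M[K]_(m, n)) t v dA :
  is_derive t v A dA -> is_derive t v (fun s => (A s)^T) dA^T.
Proof.
move=> /is_derive_mxP Ad; apply/is_derive_mxP => i j; rewrite mxE.
by rewrite (_ : (fun s => _) = (fun s => A s j i)) //; apply/funext => s; rewrite mxE.
Qed.

Lemma is_derive_dot (f g : V -> 'cV[K]_3) t v df dg :
  is_derive t v f df -> is_derive t v g dg ->
  is_derive t v (fun s => dot (f s) (g s)) (dot df (g t) + dot (f t) dg).
Proof.
move=> /is_derive_mxP fd /is_derive_mxP gd.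
rewrite (_ : (fun s => _) = (\sum_(k < 3) (fun s => f s k 0 * g s k 0))); last first.
  by apply/funext => s; rewrite fct_sumE.
rewrite /dot -big_split /=.
by apply: is_derive_sum => k; apply: is_derive_mul.
Qed.

Lemma is_derive_scale (k : V -> K) (f : V -> 'cV[K]_3) t v dk df :
  is_derive t v k dk -> is_derive t v f df ->
  is_derive t v (fun s => k s *: f s) (dk *: f t + k t *: df).
Proof.
move=> kd /is_derive_mxP fd; apply/is_derive_mxP => i j; rewrite !mxE.
rewrite (_ : (fun s => _) = (fun s => k s * f s i j)).
  exact: is_derive_mul.
by apply/funext => s; rewrite mxE.
Qed.

Lemma is_derive_cross (f g : V -> 'cV[K]_3) t v df dg :
  is_derive t v f df -> is_derive t v g dg ->
  is_derive t v (fun s => cross (f s) (g s)) (cross df (g t) + cross (f t) dg).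
Proof.
move=> /is_derive_mxP fd /is_derive_mxP gd; apply/is_derive_mxP.
have E a b c d : is_derive t v (fun s => f s a 0 * g s b 0 - f s c 0 * g s d 0)
    ((df a 0 * g t b 0 + f t a 0 * dg b 0) - (df c 0 * g t d 0 + f t c 0 * dg d 0)).
  by apply: is_derive_sub; exact: is_derive_mul.
apply: ord3_ind => j; rewrite (ord1 j) mxE /cross !vec3E;
  under eq_fun do rewrite !vec3E.
- by apply: is_derive_eq (E _ _ _ _) _; ring.
- by apply: is_derive_eq (E _ _ _ _) _; ring.
- by apply: is_derive_eq (E _ _ _ _) _; ring.
Qed.

Lemma differentiable_dot (f g : V -> 'cV[K]_3) t :
  (forall i, differentiable (fun s => f s i 0) t) ->
  (forall i, differentiable (fun s => g s i 0) t) ->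
  differentiable (fun s => dot (f s) (g s)) t.
Proof.
move=> fd gd.
rewrite (_ : (fun s => _) = (\sum_(k < 3) (fun s => f s k 0 * g s k 0))); last first.
  by apply/funext => s; rewrite fct_sumE.
by apply: differentiable_sum => k; apply: differentiableM.
Qed.

Lemma differentiable_mulmx_coord (A : 'M[K]_3) (f : V -> 'cV[K]_3) t :
  (forall i, differentiable (fun s => f s i 0) t) ->
  forall i, differentiable (fun s => (A *m f s) i 0) t.
Proof.
move=> fd i.
rewrite (_ : (fun s => _) = (\sum_(k < 3) (fun s => A i k * f s k 0))); last first.
  by apply/funext => s; rewrite fct_sumE mxE.
by apply: differentiable_sum => k; apply: differentiableZ.
Qed.

End Calculus.

(** * Differentials of the constraints and of the energy on the ambient space *)

Section Phase.
Variable K : realType.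
Implicit Types (z X Y : ambient K).

Lemma differentiable_fst (V1 V2 : normedModType K) (z : V1 * V2) :
  differentiable fst z.
Proof.
apply: (@linear_differentiable _ _ _ fst) => x.
exact: cvg_fst.
Qed.

Lemma differentiable_snd (V1 V2 : normedModType K) (z : V1 * V2) :
  differentiable snd z.
Proof.
apply: (@linear_differentiable _ _ _ snd) => x.
exact: cvg_snd.
Qed.

(** Grouping the four projections lets one differentiability result cover every scalar product in
    the constraints and in the energy. The quadratic map [e3] is not among them. *)
Definition linear_coordinate (f : ambient K -> 'cV[K]_3) :=
  [\/ f = @e1 K, f = @e2 K, f = @p1 K | f = @p2 K].

Lemma linear_coordinates :
  [/\ linear_coordinate (@e1 K), linear_coordinate (@e2 K),
      linear_coordinate (@p1 K) & linear_coordinate (@p2 K)].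
Proof.
by split; [constructor 1|constructor 2|constructor 3|constructor 4].
Qed.

Lemma differentiable_coordinate f z i :
  linear_coordinate f -> differentiable (fun s : ambient K => f s i 0) z.
Proof.
have dcoord : forall g : ambient K -> 'cV[K]_3, differentiable g z ->
    differentiable (fun s => g s i 0) z.
  move=> g gd; apply: (differentiable_comp (g := fun N : 'cV[K]_3 => N i 0) gd).
  exact: differentiable_coord.
have [dfst dsnd] : (forall w : ambient K, differentiable fst w) /\
    (forall w : ambient K, differentiable snd w).
  by split=> w; [exact: differentiable_fst|exact: differentiable_snd].
case=> ->; apply: dcoord.
- exact: (differentiable_comp (dfst z) (differentiable_fst _)).
- exact: (differentiable_comp (dfst z) (differentiable_snd _)).
- exact: (differentiable_comp (dsnd z) (differentiable_fst _)).
- exact: (differentiable_comp (dsnd z) (differentiable_snd _)).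
Qed.

Lemma differentiable_dot_coordinate z f g :
  linear_coordinate f -> linear_coordinate g ->
  differentiable (fun s : ambient K => dot (f s) (g s)) z.
Proof.
by move=> hf hg; apply: differentiable_dot => i; exact: differentiable_coordinate.
Qed.

(** The domain is any normed space, so that the rule applies both to curves in time and to the
    identity of the ambient space. *)
Lemma is_derive_ambientP (V : normedModType K) (f : V -> ambient K) t v X :
  is_derive t v f X <->
  [/\ is_derive t v (fun s => e1 (f s)) (e1 X),
      is_derive t v (fun s => e2 (f s)) (e2 X),
      is_derive t v (fun s => p1 (f s)) (p1 X) &
      is_derive t v (fun s => p2 (f s)) (p2 X)].
Proof.
split=> [/is_derive_pairP[/is_derive_pairP[? ?] /is_derive_pairP[? ?]] //|].
by case=> ? ? ? ?; do ?[apply/is_derive_pairP; split].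
Qed.

Lemma is_derive_coordinate z X :
  [/\ is_derive z X (@e1 K) (e1 X), is_derive z X (@e2 K) (e2 X),
      is_derive z X (@p1 K) (p1 X) & is_derive z X (@p2 K) (p2 X)].
Proof. by apply/is_derive_ambientP; exact: is_derive_id. Qed.

Lemma constraints_diff z X :
  'd (@constraints K) z X =
  (2 * dot (e1 z) (e1 X), 2 * dot (e2 z) (e2 X),
   dot (e1 X) (e2 z) + dot (e1 z) (e2 X),
   dot (e1 X) (p1 z) + dot (e1 z) (p1 X),
   dot (e2 X) (p2 z) + dot (e2 z) (p2 X),
   dot (e1 X) (p2 z) + dot (e1 z) (p2 X) +
   (dot (e2 X) (p1 z) + dot (e2 z) (p1 X))).
Proof.
have [d1 d2 d3 d4] := is_derive_coordinate z X.
have [c1 c2 c3 c4] := linear_coordinates.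
have dd := differentiable_dot_coordinate z.
(* The differential applied to [X] is a directional derivative provided the map is differentiable;
   that side condition is settled first, and the value is then computed component by component. *)
rewrite -deriveE; last first.
  rewrite /constraints; do ?apply: differentiable_pair; try exact: dd.
  - by apply: differentiableB; [exact: dd|exact: differentiable_cst].
  - by apply: differentiableB; [exact: dd|exact: differentiable_cst].
  - by apply: differentiableD; exact: dd.
apply: derive_val.
do ?(apply/is_derive_pairP; split => /=).
- apply: (is_derive_eq (is_derive_sub (is_derive_dot d1 d1) (is_derive_cst (1 : K) z X))).
  by rewrite (dotC (e1 X)); ring.
- apply: (is_derive_eq (is_derive_sub (is_derive_dot d2 d2) (is_derive_cst (1 : K) z X))).
  by rewrite (dotC (e2 X)); ring.
- exact: is_derive_dot.
- exact: is_derive_dot.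
- exact: is_derive_dot.
- by apply: is_derive_add; exact: is_derive_dot.
Qed.

Lemma H_diff kappa (Xi : 'M[K]_3) z X :
  'd (H_ kappa Xi) z X =
  dot (p1 z) (p1 X) + dot (p2 z) (p2 X)
  - (1 + 2 * kappa) *
    ((dot (p1 X) (e2 z) + dot (p1 z) (e2 X)) * dot (p2 z) (e1 z) +
     dot (p1 z) (e2 z) * (dot (p2 X) (e1 z) + dot (p2 z) (e1 X)))
  - (dot (Xi *m e1 X) (e2 z) + dot (Xi *m e1 z) (e2 X)).
Proof.
have [d1 d2 d3 d4] := is_derive_coordinate z X.
have [c1 c2 c3 c4] := linear_coordinates.
have dd := differentiable_dot_coordinate z.
rewrite -deriveE; last first.
  rewrite /H_ /V_I; apply: differentiableD; last first.
    apply: differentiableN; apply: differentiable_dot => i.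
      by apply: differentiable_mulmx_coord => j; exact: differentiable_coordinate.
    exact: differentiable_coordinate.
  apply: differentiableB; first apply: differentiableD; apply: differentiableZ.
  - exact: dd.
  - exact: dd.
  - by apply: differentiableM; exact: dd.
apply: derive_val; rewrite /H_ /V_I.
have dz (f : ambient K -> K) df a : is_derive z X f df ->
    is_derive z X (fun s => a * f s) (a * df) by exact: is_deriveZ.
have dXi : is_derive z X (fun s => Xi *m e1 s) (Xi *m e1 X).
  apply: (is_derive_eq (is_derive_mulmx (is_derive_cst Xi z X) d1)).
  by rewrite mul0mx add0r.
apply: is_derive_eq.
  apply: is_derive_add.
    apply: is_derive_sub; first apply: is_derive_add; apply: dz.
    - exact: (is_derive_dot d3 d3).
    - exact: (is_derive_dot d4 d4).
    - by apply: is_derive_mul; [exact: (is_derive_dot d3 d2)|exact: (is_derive_dot d4 d1)].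
  apply: is_deriveN; exact: (is_derive_dot dXi d2).
(* The halves cancel against the two equal terms that come from each squared momentum. *)
by rewrite (dotC (p1 X) (p1 z)) (dotC (p2 X) (p2 z)); field.
Qed.

End Phase.

(** * The moving orthonormal frame and the body momentum *)

Section Geometry.
Variable K : realType.
Implicit Types (z X Y : ambient K) (x y w m : 'cV[K]_3) (R : 'M[K]_3).

Lemma TstarVP z : TstarV z <->
  [/\ dot (e1 z) (e1 z) = 1, dot (e2 z) (e2 z) = 1, dot (e1 z) (e2 z) = 0 &
  [/\ dot (e1 z) (p1 z) = 0, dot (e2 z) (p2 z) = 0 &
      dot (e1 z) (p2 z) = - dot (e2 z) (p1 z)]].
Proof.
rewrite /TstarV /= /constraints; split.
  case=> /eqP + /eqP + h3 h4 h5 /eqP; rewrite !subr_eq0 addr_eq0.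
  by move=> /eqP h1 /eqP h2 /eqP h6.
by case=> -> -> -> [-> -> ->]; rewrite !subrr addNr.
Qed.

(** The unit length of [e3] is Lagrange's identity for two cross products. The nine values form one
    multirule, so that a single rewrite evaluates any combination of frame vectors. *)
Lemma frame_dots z : TstarV z ->
  ((dot (e1 z) (e1 z) = 1) * (dot (e1 z) (e2 z) = 0) * (dot (e1 z) (e3 z) = 0)) *
  ((dot (e2 z) (e1 z) = 0) * (dot (e2 z) (e2 z) = 1) * (dot (e2 z) (e3 z) = 0)) *
  ((dot (e3 z) (e1 z) = 0) * (dot (e3 z) (e2 z) = 0) * (dot (e3 z) (e3 z) = 1)).
Proof.
case/TstarVP=> h1 h2 h3 _.
have h4 : dot (e3 z) (e3 z) = 1.
  by rewrite /e3 dot_cross_cross h1 h2 (dotC (e2 z)) h3 mulr0 subr0 mulr1.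
by rewrite (dotC (e2 z) (e1 z)) !(dotC (e3 z) (_ z)) h1 h2 h3 h4 dot_crossl dot_crossr.
Qed.

(** Both nontrivial products come from expanding [(e1 x e2) x v], with [v] equal to [e2] or to
    [e1]. *)
Lemma frame_crosses z : TstarV z ->
  [/\ cross (e1 z) (e2 z) = e3 z, cross (e2 z) (e3 z) = e1 z &
      cross (e3 z) (e1 z) = e2 z].
Proof.
move=> hz; have D := frame_dots hz.
split=> //; first rewrite crossC; rewrite {1}/e3 cross_crossl !D.
  by rewrite scale0r sub0r opprK scale1r.
by rewrite scale0r subr0 scale1r.
Qed.

Lemma frameE z i :
  (frame z i 0 = e1 z i 0) * (frame z i 1 = e2 z i 0) *
  (frame z i 2%:R = e3 z i 0).
Proof. by rewrite !mxE. Qed.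

Lemma frame_tr_mul z x :
  (frame z)^T *m x = vec3 (dot (e1 z) x) (dot (e2 z) x) (dot (e3 z) x).
Proof.
by apply: col3P; rewrite vec3E !dotE mxE sum_ord3 !(mxE trmx_key) !frameE.
Qed.

Lemma frame_mul z x :
  frame z *m x = x 0 0 *: e1 z + x 1 0 *: e2 z + x 2%:R 0 *: e3 z.
Proof.
by apply/matrixP => i j; rewrite (ord1 j) !mxE sum_ord3 !mxE /=; ring.
Qed.

Lemma frame_trK z : TstarV z -> (frame z)^T *m frame z = 1%:M.
Proof.
move=> hz; have D := frame_dots hz.
apply/matrixP => i; apply: ord3_ind.
- transitivity (((frame z)^T *m e1 z) i 0).
    by rewrite !mxE; apply: eq_bigr => k _; rewrite frameE.
  by rewrite frame_tr_mul !D; move: i; apply: ord3_ind; rewrite vec3E mxE.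
- transitivity (((frame z)^T *m e2 z) i 0).
    by rewrite !mxE; apply: eq_bigr => k _; rewrite frameE.
  by rewrite frame_tr_mul !D; move: i; apply: ord3_ind; rewrite vec3E mxE.
- transitivity (((frame z)^T *m e3 z) i 0).
    by rewrite !mxE; apply: eq_bigr => k _; rewrite frameE.
  by rewrite frame_tr_mul !D; move: i; apply: ord3_ind; rewrite vec3E mxE.
Qed.

Lemma frame_mulK z : TstarV z -> frame z *m (frame z)^T = 1%:M.
Proof. by move=> /frame_trK /mulmx1C. Qed.

Lemma frame_expand z x : TstarV z ->
  x = dot (e1 z) x *: e1 z + dot (e2 z) x *: e2 z + dot (e3 z) x *: e3 z.
Proof.
move=> hz; rewrite -[LHS]mul1mx -(frame_mulK hz) -mulmxA frame_mul.
by rewrite frame_tr_mul !vec3E.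
Qed.

(** Comparison by body components: the explicit formulas for momenta and for tangent vectors are
    verified in this way. *)
Lemma frame_eq z x y : TstarV z -> dot (e1 z) x = dot (e1 z) y ->
  dot (e2 z) x = dot (e2 z) y -> dot (e3 z) x = dot (e3 z) y -> x = y.
Proof.
by move=> hz h1 h2 h3; rewrite (frame_expand x hz) h1 h2 h3 -frame_expand.
Qed.

Lemma col_frame z :
  (col 0 (frame z) = e1 z) * (col 1 (frame z) = e2 z) *
  (col 2%:R (frame z) = e3 z).
Proof. by do !split; apply/matrixP => i j; rewrite (ord1 j) mxE frameE. Qed.

Lemma frame_SO3 z : TstarV z -> SO3 (frame z).
Proof.
move=> hz; split; first exact: frame_trK.
by rewrite det_mx3 !col_frame -/(e3 z) (frame_dots hz).
Qed.

(** Conjugation by the frame turns [wedge x y] into the wedge of the body components of [x] and [y].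
    Those of [e1] and [e2] are standard basis vectors, so each entry reduces to components of the
    momenta. *)
Lemma body_momentumE z : TstarV z -> body_momentum z =
  vec3 (dot (p2 z) (e3 z)) (- dot (p1 z) (e3 z))
       (dot (p1 z) (e2 z) - dot (p2 z) (e1 z)).
Proof.
move=> hz; have D := frame_dots hz.
have W x y : (frame z)^T *m wedge x y *m frame z =
    wedge ((frame z)^T *m x) ((frame z)^T *m y).
  by rewrite /wedge !trmx_mul !trmxK mulmxBr mulmxBl !mulmxA.
have WE x y i j : wedge x y i j = x i 0 * y j 0 - y i 0 * x j 0.
  by rewrite /wedge !mxE !big_ord1 !mxE.
have DE x y u v i j : (wedge x y + wedge u v) i j =
    x i 0 * y j 0 - y i 0 * x j 0 + (u i 0 * v j 0 - v i 0 * u j 0).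
  by rewrite mxE !WE.
rewrite /body_momentum /Phi0 mulmxDr mulmxDl !W /vee.
by apply: col3P; rewrite !vec3E !DE !frame_tr_mul !vec3E !D
  ?(dotC (p1 z) (_ z)) ?(dotC (p2 z) (_ z)); ring.
Qed.

End Geometry.

(** * Body coordinates on the phase space and on its tangent spaces *)

Section Lift.
Variable K : realType.
Implicit Types (z X Y : ambient K) (x y w m : 'cV[K]_3) (R : 'M[K]_3).

(** The inverse of [correspondence]. The halves arise because the last constraint makes [<p1,e2>]
    and [<p2,e1>] opposite while their difference is M3, so they equal M3/2 and -M3/2. *)
Definition of_body (R : 'M[K]_3) (m : 'cV[K]_3) : ambient K :=
  ((col 0 R, col 1 R),
   ((m 2%:R 0 / 2) *: col 1 R - m 1 0 *: col 2%:R R,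
    m 0 0 *: col 2%:R R - (m 2%:R 0 / 2) *: col 0 R)).

Lemma p1E z : TstarV z -> p1 z =
  (body_momentum z 2%:R 0 / 2) *: e2 z - body_momentum z 1 0 *: e3 z.
Proof.
move=> hz; have D := frame_dots hz; have [_ _ _ [h1 h2 h3]] := (TstarVP z).1 hz.
apply: (frame_eq hz); rewrite !dot_lin !D body_momentumE // !vec3E.
- by rewrite h1; ring.
- by rewrite (dotC (p2 z) (e1 z)) h3 (dotC (p1 z) (e2 z)); field.
- by rewrite (dotC (p1 z) (e3 z)); ring.
Qed.

Lemma p2E z : TstarV z -> p2 z =
  body_momentum z 0 0 *: e3 z - (body_momentum z 2%:R 0 / 2) *: e1 z.
Proof.
move=> hz; have D := frame_dots hz; have [_ _ _ [h1 h2 h3]] := (TstarVP z).1 hz.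
apply: (frame_eq hz); rewrite !dot_lin !D body_momentumE // !vec3E.
- by rewrite (dotC (p2 z) (e1 z)) h3 (dotC (p1 z) (e2 z)); field.
- by rewrite h2; ring.
- by rewrite (dotC (p2 z) (e3 z)); ring.
Qed.

Lemma correspondenceK z :
  TstarV z -> of_body (frame z) (body_momentum z) = z.
Proof.
move=> hz; rewrite /of_body !col_frame -p1E // -p2E //.
by case: z {hz} => -[? ?] [? ?].
Qed.

Lemma of_bodyK R m : SO3 R ->
  TstarV (of_body R m) /\ correspondence (of_body R m) = (R, m).
Proof.
rewrite /SO3 /=; case=> RR detR; set z := of_body R m.
have D : forall i j, dot (col i R) (col j R) = (i == j)%:R.
  move=> i j; move/matrixP : (RR) => /(_ i j); rewrite !mxE => <-.
  by apply: eq_bigr => k _; rewrite !mxE.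
(* In the basis of columns of [R], the first two components of [e3] vanish because a cross product
   is orthogonal to its factors; the third is the determinant, hence 1. *)
have c3 : e3 z = col 2%:R R.
  have /mulmx1C RR' := RR.
  rewrite -[LHS]mul1mx -RR' -mulmxA colE; congr (_ *m _).
  have E i : (R^T *m e3 z) i 0 = dot (col i R) (e3 z).
    by rewrite mxE; apply: eq_bigr => k _; rewrite !mxE.
  by apply: col3P; rewrite E mxE /e3 /= ?dot_crossl ?dot_crossr // -det_mx3.
have hz : TstarV z.
  apply/TstarVP; rewrite /z /of_body /e1 /e2 /p1 /p2 /= !dot_lin !D /=.
  by do ?split; rewrite ?(mulr0, subr0, mulr1, sub0r, oppr0, subrr, opprK, addr0).
have hf : frame z = R.
  apply/matrixP => i j; move: j; apply: ord3_ind; rewrite ?frameE ?c3 ?mxE //.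
split=> //; rewrite /correspondence hf; congr (_, _).
rewrite body_momentumE // c3 /z /of_body /e1 /e2 /p1 /p2 /= !dot_lin !D /=.
by apply: col3P; rewrite vec3E; field.
Qed.

(* The derivative of [of_body] at (frame z, body_momentum z) in the direction
   R' = R hat(w), M' = m. *)
Definition lift z w m : ambient K :=
  let M := body_momentum z in
  let d1 := w 2%:R 0 *: e2 z - w 1 0 *: e3 z in
  let d2 := w 0 0 *: e3 z - w 2%:R 0 *: e1 z in
  let d3 := w 1 0 *: e1 z - w 0 0 *: e2 z in
  ((d1, d2),
   ((m 2%:R 0 / 2) *: e2 z + (M 2%:R 0 / 2) *: d2 - m 1 0 *: e3 z - M 1 0 *: d3,
    m 0 0 *: e3 z + M 0 0 *: d3 - (m 2%:R 0 / 2) *: e1 z - (M 2%:R 0 / 2) *: d1)).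

Lemma liftE z w m (M := body_momentum z)
    (d1 := w 2%:R 0 *: e2 z - w 1 0 *: e3 z)
    (d2 := w 0 0 *: e3 z - w 2%:R 0 *: e1 z)
    (d3 := w 1 0 *: e1 z - w 0 0 *: e2 z) :
  (e1 (lift z w m) = d1) * (e2 (lift z w m) = d2) *
  (p1 (lift z w m) = (m 2%:R 0 / 2) *: e2 z + (M 2%:R 0 / 2) *: d2
     - m 1 0 *: e3 z - M 1 0 *: d3) *
  (p2 (lift z w m) = m 0 0 *: e3 z + M 0 0 *: d3
     - (m 2%:R 0 / 2) *: e1 z - (M 2%:R 0 / 2) *: d1).
Proof. by []. Qed.

(** Once the momenta are written in body form, the linearized constraints fix six of the twelve
    frame components of [X]; the other six determine [w] and [m]. *)
Lemma tangent_lift z X : TstarV z ->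
  tangent z X <-> exists w m, X = lift z w m.
Proof.
move=> hz; have D := frame_dots hz.
rewrite /tangent /= constraints_diff (p1E hz) (p2E hz); split; last first.
  case=> w [m ->]; rewrite !liftE !dot_lin !D.
  by congr (_, _, _, _, _, _); ring.
case=> + + + + + +; rewrite !dot_lin.
set M0 := body_momentum z 0 0; set M1 := body_momentum z 1 0.
set M2 := body_momentum z 2%:R 0.
set d1 := e1 X; set d2 := e2 X; set q1 := p1 X; set q2 := p2 X.
rewrite (dotC d1 (e2 z)) (dotC d1 (e3 z)) (dotC d1 (e1 z)).
rewrite (dotC d2 (e2 z)) (dotC d2 (e3 z)) (dotC d2 (e1 z)) => h1 h2 h3 h4 h5 h6.
have {}h1 : dot (e1 z) d1 = 0 by lra.
have {}h2 : dot (e2 z) d2 = 0 by lra.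
have {}h3 : dot (e1 z) d2 = - dot (e2 z) d1 by lra.
rewrite h1 h2 h3 in h4 h5 h6.
(* [w] is read off from the components of [d1] and [d2] in [lift]. Then [m] is solved from
   [<e3,q2>], [<e3,q1>] and [<e2,q1>], after subtracting the contribution of the rotating frame. *)
pose w := vec3 (dot (e3 z) d2) (- dot (e3 z) d1) (dot (e2 z) d1).
pose m := vec3 (dot (e3 z) q2 - M2 / 2 * w 1 0)
  (- dot (e3 z) q1 + M2 / 2 * w 0 0)
  (2 * (dot (e2 z) q1 - M1 * w 0 0)).
exists w, m.
have E1 : d1 = e1 (lift z w m).
  by apply: (frame_eq hz); rewrite liftE !dot_lin !D !vec3E; lra.
have E2 : d2 = e2 (lift z w m).
  by apply: (frame_eq hz); rewrite liftE !dot_lin !D !vec3E; lra.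
have E3 : q1 = p1 (lift z w m).
  by apply: (frame_eq hz); rewrite liftE -/M0 -/M1 -/M2 !dot_lin !D !vec3E; lra.
have E4 : q2 = p2 (lift z w m).
  by apply: (frame_eq hz); rewrite liftE -/M0 -/M1 -/M2 !dot_lin !D !vec3E; lra.
rewrite -[RHS]/((e1 (lift z w m), e2 (lift z w m)),
  (p1 (lift z w m), p2 (lift z w m))).
rewrite -E1 -E2 -E3 -E4 /d1 /d2 /q1 /q2.
by case: X @d1 @d2 @q1 @q2 @w @m {h1 h2 h3 h4 h5 h6 E1 E2 E3 E4} => -[? ?] [? ?].
Qed.

(** The part without [eta] is the canonical form of the cotangent bundle of SO(3) in body
    coordinates. In the twist only the products of [e3] components survive; they give [eta] times
    the third component of [cross w w'], which acts as a shift of the body momentum by [- eta] along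
    the third axis. *)
Lemma omega_lift eta z w m w' m' : TstarV z ->
  omega eta (lift z w m) (lift z w' m') =
  dot m w' - dot m' w
  - dot (body_momentum z + vec3 0 0 (- eta)) (cross w w').
Proof.
move=> hz; have D := frame_dots hz.
set E1 := e1 z in D *; set E2 := e2 z in D *; set E3 := e3 z in D *.
rewrite /omega !liftE -/E1 -/E2 -/E3.
rewrite !dot_lin !D !dotE /cross !vec3E.
set M := body_momentum z; rewrite !mxE /=.
by field.
Qed.
End Lift.

(** * The Hamiltonian vector field in body coordinates *)

Definition angular_velocity (K : realType) (kappa : K) (z : ambient K) :=
  let M := body_momentum z in
  vec3 (M 0 0) (M 1 0) ((1 + kappa) * M 2%:R 0).

(** The right-hand side of the Euler equation as a function on the phase space. The inverse inertia
    operator is already written out here; its agreement with [invmx] is checked in the final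
    theorem. *)
Definition momentum_rate (K : realType) (eta chi3 kappa : K) (gamma : 'cV[K]_3)
    (z : ambient K) :=
  cross (body_momentum z + vec3 0 0 (- eta)) (angular_velocity kappa z)
  + cross ((frame z)^T *m gamma) (vec3 0 0 chi3).

Section Dynamics.
Variables (K : realType) (eta chi3 kappa : K) (gamma : 'cV[K]_3) (Xi : 'M[K]_3).
Hypothesis XiE : forall w : 'cV[K]_3, Xi *m w = - chi3 *: cross gamma w.
Implicit Types (z X Y : ambient K) (x y w m : 'cV[K]_3) (R : 'M[K]_3).

Lemma dot_Xi x y : dot (Xi *m x) y = - chi3 * dot gamma (cross x y).
Proof. by rewrite XiE dotZl triple. Qed.

Lemma Xi_so3 : so3 Xi.
Proof.
have -> : Xi = - chi3 *: hat gamma.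
  apply/matrixP => i j.
  have colj (A : 'M[K]_3) : A i j = (A *m delta_mx j 0 : 'cV_3) i 0.
    by rewrite -colE mxE.
  by rewrite !colj XiE -scalemxAl hat_mul.
by rewrite /so3 /= [LHS]linearZ /= hat_tr scalerN.
Qed.

Lemma V_IE z : V_I Xi z = chi3 * dot gamma (e3 z).
Proof. by rewrite /V_I dot_Xi mulNr opprK. Qed.

(** On the phase space the kinetic part equals (M1^2 + M2^2 + (1 + kappa) M3^2)/2. It depends on M
    alone, which yields the term in [m]; the rotation [w] acts only through the potential. *)
Lemma H_diff_lift z w m : TstarV z ->
  'd (H_ kappa Xi) z (lift z w m) =
  dot (angular_velocity kappa z) m +
  dot (vec3 0 0 chi3) (cross ((frame z)^T *m gamma) w).
Proof.
move=> hz; have D := frame_dots hz; have [C1 C2 C3] := frame_crosses hz.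
rewrite H_diff !dot_Xi !liftE !cross_lin !cross_self (crossC (e3 z) (e2 z)) C2.
rewrite (crossC (e1 z) (e3 z)) C3 (p1E hz) (p2E hz).
rewrite frame_tr_mul /angular_velocity.
set M0 := body_momentum z 0 0; set M1 := body_momentum z 1 0.
set M2 := body_momentum z 2%:R 0.
rewrite !dot_lin !D !(dotE _ m) (dotE _ (cross _ _)) /cross !vec3E.
have -> : dot gamma 0 = 0 by rewrite dotE !mxE; ring.
by rewrite !(dotC gamma (_ z)); field.
Qed.

Lemma hamiltonian_vectorE z X : TstarV z ->
  hamiltonian_vector eta (H_ kappa Xi) z X <->
  X = lift z (angular_velocity kappa z) (momentum_rate eta chi3 kappa gamma z).
Proof.
move=> hz; rewrite /hamiltonian_vector (tangent_lift X hz).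
set N := body_momentum z + vec3 0 0 (- eta); set G := (frame z)^T *m gamma.
set chi := vec3 0 0 chi3.
split=> [[[w [m ->]]] h|->].
  have {}h w' m' : dot m w' - dot m' w - dot N (cross w w') =
      - (dot (angular_velocity kappa z) m' + dot chi (cross G w')).
    rewrite -(omega_lift _ _ _ _ _ hz) -(H_diff_lift _ _ hz).
    by apply: h; apply/tangent_lift => //; exists w', m'.
  have hw : w = angular_velocity kappa z.
    apply: dot_eq => v; move: (h 0 v).
    rewrite (dotC (angular_velocity kappa z)).
    have c0 u : cross u 0 = 0 by apply: col3P; rewrite !mxE /=; ring.
    have d0 u : dot u 0 = 0 by rewrite dotE !mxE; ring.
    rewrite !c0 !d0; lra.
  have hm : m = momentum_rate eta chi3 kappa gamma z.
    apply: dot_eq => v; move: (h v 0).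
    have d0 u : dot u 0 = 0 by rewrite dotE !mxE; ring.
    (* Cyclic permutation of the triple products brings the test vector [v] to the front, so that
       its coefficients can be compared. *)
    rewrite (dotC 0) !d0 (triple_cycle N) (triple_cycle chi) (crossC chi) dotNr.
    rewrite /momentum_rate -/N -/G -/chi dot_lin hw (dotC m); lra.
  by rewrite hw hm.
split.
  by exists (angular_velocity kappa z), (momentum_rate eta chi3 kappa gamma z).
move=> Y /(tangent_lift _ hz)[w' [m' ->]].
rewrite omega_lift // H_diff_lift // -/G -/chi /momentum_rate -/N -/G -/chi.
rewrite (triple_cycle N) (triple_cycle chi) (crossC chi) dotNr dot_lin !(dotC _ w') (dotC m').
ring.
Qed.

End Dynamics.

(** * Velocities of curves in terms of the frame and the body momentum *)

Section Kinematics.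
Variable K : realType.
Implicit Types (z X Y : ambient K) (x y w m : 'cV[K]_3) (R : 'M[K]_3).

Lemma is_derive_col (A : K -> 'M[K]_3) (t : K) dA j :
  is_derive t 1 A dA -> is_derive t 1 (fun s => col j (A s)) (col j dA).
Proof.
move=> /is_derive_mxP Ad; apply/is_derive_mxP => i k; rewrite mxE.
rewrite (_ : (fun s => _) = (fun s => A s i j)); first exact: Ad.
by apply/funext => s; rewrite mxE.
Qed.

Lemma frame_hat z w :
  (col 0 (frame z *m hat w) = w 2%:R 0 *: e2 z - w 1 0 *: e3 z) *
  (col 1 (frame z *m hat w) = w 0 0 *: e3 z - w 2%:R 0 *: e1 z) *
  (col 2%:R (frame z *m hat w) = w 1 0 *: e1 z - w 0 0 *: e2 z).
Proof.
have E j : col j (frame z *m hat w) = frame z *m col j (hat w).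
  by rewrite !colE mulmxA.
by rewrite !E !frame_mul; do !split; apply/matrixP => i k;
  rewrite !mxE /=; ring.
Qed.

Lemma is_derive_scalar_pair (k l : K -> K) (f g : K -> 'cV[K]_3) (t : K) dk dl df dg :
  is_derive t 1 k dk -> is_derive t 1 l dl ->
  is_derive t 1 f df -> is_derive t 1 g dg ->
  is_derive t 1 (fun s => k s *: f s - l s *: g s)
    (dk *: f t + k t *: df - (dl *: g t + l t *: dg)).
Proof. by move=> ? ? ? ?; apply: is_derive_sub; exact: is_derive_scale. Qed.

(** The constraints are assumed near [t] because each direction differentiates a formula that holds
    only on the phase space: the explicit body momentum in one, the inverse [of_body] in the
    other. *)
Lemma is_derive_lift (z : K -> ambient K) (t : K) w m :
  (\near t, TstarV (z t)) ->
  is_derive t 1 z (lift (z t) w m) <->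
  is_derive t 1 (fun s => frame (z s)) (frame (z t) *m hat w) /\
  is_derive t 1 (fun s => body_momentum (z s)) m.
Proof.
move=> nz; have hz := nbhs_singleton nz.
split=> [/is_derive_ambientP[d1 d2 q1 q2]|[dA dM]].
  have [C1 C2 C3] := frame_crosses hz.
  have d3 : is_derive t 1 (fun s => e3 (z s)) (w 1 0 *: e1 (z t) - w 0 0 *: e2 (z t)).
    apply: (is_derive_eq (is_derive_cross d1 d2)).
    rewrite !liftE !cross_lin !cross_self (crossC (e3 _) (e2 _)) C2.
    rewrite (crossC (e1 _) (e3 _)) C3.
    by rewrite !scaler0 !subr0 add0r scalerN scalerN opprK.
  split.
    apply/is_derive_mxP => i j.
    have colj (A : 'M[K]_3) : A i j = col j A i 0 by rewrite mxE.
    rewrite colj; under eq_fun do rewrite colj.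
    move: i {colj}.
    suff : is_derive t 1 (fun s => col j (frame (z s))) (col j (frame (z t) *m hat w)).
      by move=> /is_derive_mxP.
    move: j; apply: ord3_ind; rewrite frame_hat; under eq_fun do rewrite col_frame.
    - exact: d1.
    - exact: d2.
    - exact: d3.
  apply: (near_eq_is_derive
    (f := fun s => vec3 (dot (p2 (z s)) (e3 (z s))) (- dot (p1 (z s)) (e3 (z s)))
       (dot (p1 (z s)) (e2 (z s)) - dot (p2 (z s)) (e1 (z s))))).
    by near=> s; rewrite body_momentumE //; near: s.
  have D := frame_dots hz.
  have pE := (p1E hz, p2E hz).
  apply/is_derive_mxP; apply: ord3_ind => j; rewrite (ord1 j);
    under eq_fun do rewrite vec3E.
  - apply: (is_derive_eq (is_derive_dot q2 d3)).
    by rewrite !liftE !pE !dot_lin !D; field.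
  - apply: (is_derive_eq (is_derive_opp (is_derive_dot q1 d3))).
    by rewrite !liftE !pE !dot_lin !D; field.
  - apply: (is_derive_eq (is_derive_sub (is_derive_dot q1 d2) (is_derive_dot q2 d1))).
    by rewrite !liftE !pE !dot_lin !D; field.
(* Conversely, the curve is recovered near [t] from its frame and body momentum, whose derivatives
   are known. *)
apply: (near_eq_is_derive
    (f := fun s => of_body (frame (z s)) (body_momentum (z s)))).
  by near=> s; rewrite correspondenceK //; near: s.
have dM' i : is_derive t 1 (fun s => body_momentum (z s) i 0) (m i 0).
  by move/is_derive_mxP : dM => /(_ i 0).
have dM2 : is_derive t 1 (fun s => body_momentum (z s) 2%:R 0 / 2) (m 2%:R 0 / 2).
  apply: (is_derive_eq (is_derive_mul (dM' 2%:R) (is_derive_cst (2^-1 : K) t 1))).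
  by rewrite mulr0 addr0.
have c0 := is_derive_col 0 dA; have c1 := is_derive_col 1 dA.
have c2 := is_derive_col 2%:R dA.
rewrite !frame_hat in c0 c1 c2.
apply/is_derive_ambientP; split; rewrite ?liftE.
- exact: c0.
- exact: c1.
- apply: (is_derive_eq (is_derive_scalar_pair dM2 (dM' 1) c1 c2)).
  by rewrite !col_frame opprD addrA.
- apply: (is_derive_eq (is_derive_scalar_pair (dM' 0) dM2 c2 c0)).
  by rewrite !col_frame opprD addrA.
Unshelve. all: by end_near. Qed.

End Kinematics.

Theorem proposition2 (K : realType) (eta chi3 kappa : K) (gamma : 'cV[K]_3)
    (Xi : 'M[K]_3)
    (hkappa : -1 < kappa)
    (hgamma : dot gamma gamma = 1)
    (hXi : forall w : 'cV[K]_3, Xi *m w = - chi3 *: cross gamma w) :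
  let I := diag_mx (vec3 1 1 (1 + kappa)^-1)^T in
  let L := vec3 0 0 (- eta) in
  let chi := vec3 0 0 chi3 in
  [/\ so3 Xi,
      forall z : ambient K, V_I Xi z = chi3 * dot gamma (e3 z),
      lagrange_top_gyrostat I L chi
    & represents eta (H_ kappa Xi) I L chi gamma].
Proof.
move=> I L chi.
(* This makes the third moment of inertia positive and the inertia operator invertible. *)
have kappa1 : 0 < 1 + kappa by lra.
split.
- exact: Xi_so3 hXi.
- by move=> z; apply: V_IE.
- by exists 1, (1 + kappa)^-1, (- eta), chi3; split; rewrite ?invr_gt0.
have hamE := hamiltonian_vectorE eta kappa hXi.
have OmegaE z : invmx I *m body_momentum z = angular_velocity kappa z.
  (* [J] is the explicit inverse of [I]: writing the momentum as [I *m (J *m _)] lets [invmx I]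
     cancel. *)
  pose J : 'M[K]_3 := diag_mx (vec3 1 1 (1 + kappa))^T.
  have JE x : J *m x = vec3 (x 0 0) (x 1 0) ((1 + kappa) * x 2%:R 0).
    by apply: col3P; rewrite mul_diag_mx !mxE /= ?mul1r.
  have IE x : I *m x = vec3 (x 0 0) (x 1 0) ((1 + kappa)^-1 * x 2%:R 0).
    by apply: col3P; rewrite mul_diag_mx !mxE /= ?mul1r.
  have IJ (x : 'cV[K]_3) : I *m (J *m x) = x.
    rewrite JE IE; apply: col3P; rewrite !vec3E // mulrA mulVf ?mul1r //.
    exact: lt0r_neq0.
  have uI : I \in unitmx.
    rewrite unitmxE det_diag unitfE; apply/prodf_neq0 => i _; rewrite !mxE.
    by move: i; apply: ord3_ind; rewrite /= ?oner_neq0 // invr_neq0 ?lt0r_neq0.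
  by rewrite -{1}(IJ (body_momentum z)) mulKmx ?JE.
split.
- split.
  + by move=> z hz; split=> //; exact: frame_SO3.
  + move=> z1 z2 /set_mem h1 /set_mem h2 [h3 h4].
    by rewrite -(correspondenceK h1) -(correspondenceK h2) h3 h4.
  + move=> [R m] [/= hR _]; have [hz hc] := of_bodyK m hR.
    by exists (of_body R m).
- move=> z hz; exists (lift z (angular_velocity kappa z)
    (momentum_rate eta chi3 kappa gamma z)); split; first exact/hamE.
  by move=> X /(hamE _ _ hz) ->.
move=> J z [oJ _] zT.
(* The equivalence holds at each time separately. Uniqueness of the Hamiltonian vector then replaces
   the existential in [integral_curve] by this explicit lift. *)
have key t : J t ->
    is_derive t 1 z (lift (z t) (angular_velocity kappa (z t))
      (momentum_rate eta chi3 kappa gamma (z t))) <->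
    euler_poisson I L chi gamma
      (fun s => frame (z s)) (fun s => body_momentum (z s)) t.
  move=> Jt.
  (* Openness of [J] extends the constraints from [t] to a neighbourhood. *)
  have near_zT : \near t, TstarV (z t).
    by apply: filterS (open_nbhs_nbhs (conj oJ Jt)).
  rewrite is_derive_lift // /euler_poisson OmegaE.
  split=> [[dA dM]|[]//]; split=> //.
  (* The Poisson equation comes from differentiating [R^T gamma] with [gamma] fixed: skewness of
     [hat] turns the transpose of [R hat(Omega)] into [- hat(Omega) R^T], and the sign reverses the
     cross product. *)
  have := is_derive_mulmx (is_derive_trmx dA) (is_derive_cst gamma t 1).
  move=> dG; apply: (is_derive_eq dG).
  rewrite mulmx0 addr0 trmx_mul hat_tr mulNmx mulNmx -mulmxA hat_mul.
  by rewrite crossC opprK.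
split=> hyp t Jt.
  apply/key => //; have [X /hamE -> //] := hyp t Jt; exact: zT.
have /key hd := hyp t Jt.
by eexists; [apply/hamE; [exact: zT|reflexivity]|exact: hd].
Qed.
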